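(* Let $\mathcal C=\mathcal C(I,A,(\rho_i)_{i\in I},(C^a)_{a\in A})$ be a Cartan scheme of rank three. Assume that $\mathcal R^{\mathrm{re}}(\mathcal C)$ is a finite irreducible root system of type $\mathcal C$. Then all entries of the Cartan matrices of $\mathcal C$ are greater than or equal to $-7$; that is, $c^a_{ij}\ge -7$ for all $a\in A$ and $i,j\in I$.
   Context: Notation: $\mathbb N=\{1,2,3,\dots\}$, $\mathbb N_0=\mathbb N\cup\{0\}$. Let $I$ be a non-empty finite set and $\{\alpha_i\mid i\in I\}$ the standard basis of $\mathbb Z^I$ (the $\alpha_i$ are the simple roots). A generalized Cartan matrix is $C=(c_{ij})_{i,j\in I}\in\mathbb Z^{I\times I}$ with $c_{ii}=2$, $c_{jk}\le 0$ for $j\ne k$, and $c_{ij}=0\Rightarrow c_{ji}=0$. A Cartan scheme $\mathcal C=\mathcal C(I,A,(\rho_i)_{i\in I},(C^a)_{a\in A})$ consists of a non-empty set $A$ (the objects), maps $\rho_i:A\to A$ ($i\in I$), and generalized Cartan matrices $C^a=(c^a_{jk})_{j,k\in I}$ ($a\in A$) such that $\rho_i^2=\mathrm{id}$ and $c^a_{ij}=c^{\rho_i(a)}_{ij}$ for all $a\in A$, $i,j\in I$. Its rank is $\#I$. Define $\sigma_i^a\in\mathrm{Aut}(\mathbb Z^I)$ by $\sigma_i^a(\alpha_j)=\alpha_j-c^a_{ij}\alpha_i$ for all $j\in I$. The Weyl groupoid $\mathcal W(\mathcal C)$ is the category with object set $A$ whose morphisms are the compositions of the maps $\sigma_i^a$,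 where $\sigma_i^a$ is regarded as an element of $\mathrm{Hom}(a,\rho_i(a))$; so each $w\in\mathrm{Hom}(a,b)$ is an automorphism of $\mathbb Z^I$. The set of real roots at $a$ is $R^a=\{w(\alpha_j)\mid b\in A,\ w\in\mathrm{Hom}(b,a),\ j\in I\}$, and $R^a_+=R^a\cap\mathbb N_0^I$. Put $m^a_{i,j}=\#(R^a\cap(\mathbb N_0\alpha_i+\mathbb N_0\alpha_j))$. The pair $\mathcal R^{\mathrm{re}}(\mathcal C)=(\mathcal C,(R^a)_{a\in A})$ is called a root system of type $\mathcal C$ if for all $a\in A$ and $i,j\in I$: (R1) $R^a=R^a_+\cup -R^a_+$; (R2) $R^a\cap\mathbb Z\alpha_i=\{\alpha_i,-\alpha_i\}$; (R3) $\sigma_i^a(R^a)=R^{\rho_i(a)}$; (R4) if $i\ne j$ and $m^a_{i,j}$ is finite then $(\rho_i\rho_j)^{m^a_{i,j}}(a)=a$. It is finite if $R^a$ is finite for all $a\in A$. A finite root system $\mathcal R^{\mathrm{re}}(\mathcal C)$ of type $\mathcal C$ is irreducible if and only if the matrix $C^a$ is indecomposable for every $a\in A$ (this may be taken as the definition). *)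

(* Defs.v *)
From mathcomp Require Import all_boot all_order all_algebra finmap.
From mathcomp Require Import all_classical.
Set Implicit Arguments.
Unset Strict Implicit.
Unset Printing Implicit Defensive.
Import Order.TTheory GRing.Theory Num.Theory.
Local Open Scope classical_set_scope.
Local Open Scope ring_scope.

Notation root_lattice I := {ffun I -> int}.

Definition alpha (I : finType) (i : I) : root_lattice I :=
  [ffun k => (k == i)%:Z].

Definition generalized_cartan (I : finType) (c : I -> I -> int) : Prop :=
  [/\ forall i, c i i = 2,
      forall j k, j != k -> c j k <= 0
    & forall i j, c i j = 0 -> c j i = 0].

Record cartan_scheme (I : finType) (A : Type) := CartanScheme {
  rho : I -> A -> A;
  cartan : A -> I -> I -> int;
  objects_inhabited : inhabited A;
  cartan_gcm : forall a, generalized_cartan (cartan a);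
  rhoK : forall i, involutive (rho i);
  cartan_rho : forall a i j, cartan a i j = cartan (rho i a) i j
}.

Definition rank (I : finType) (A : Type) (C : cartan_scheme I A) : nat := #|I|.

Section CartanScheme.
Variables (I : finType) (A : Type) (C : cartan_scheme I A).

(* The additive extension of alpha j |-> alpha j - c^a_ij alpha i. *)
Definition sigma (a : A) (i : I) (v : root_lattice I) : root_lattice I :=
  \sum_(j : I) (alpha j - alpha i *~ cartan C a i j) *~ v j.

(* weyl_hom a b w : w is a morphism from a to b of the Weyl groupoid. *)
Inductive weyl_hom (a : A) : A -> (root_lattice I -> root_lattice I) -> Prop :=
| weyl_id : weyl_hom a a id
| weyl_comp b w i :
    weyl_hom a b w -> weyl_hom a (rho C i b) (sigma b i \o w).

Definition real_roots (a : A) : set (root_lattice I) :=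
  [set v | exists b w j, weyl_hom b a w /\ v = w (alpha j)].

Section RootSystem.
Variable R : A -> set (root_lattice I).

Definition positive_roots (a : A) : set (root_lattice I) :=
  R a `&` [set v : root_lattice I | forall i, 0 <= v i].

Definition rank_two_roots (a : A) (i j : I) : set (root_lattice I) :=
  R a `&`
      [set v | exists k l : nat, v = alpha i *+ k + alpha j *+ l].

(* Only meaningful when rank_two_roots a i j is finite: fset_set sends an
   infinite set to the empty one. *)
Definition m_ (a : A) (i j : I) : nat := #|` fset_set (rank_two_roots a i j) |.

Definition is_root_system : Prop :=
  [/\ forall a, R a = positive_roots a `|` [set - v | v in positive_roots a],
      forall a i,
        R a `&` [set v | exists n : int, v = alpha i *~ n]
          = [set alpha i; - alpha i],
      forall a i, sigma a i @` R a = R (rho C i a)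
    & forall a i j, i != j -> finite_set (rank_two_roots a i j) ->
        iter (m_ a i j) (rho C i \o rho C j) a = a].

Definition finite_roots : Prop := forall a, finite_set (R a).

End RootSystem.

Definition decomposable (c : I -> I -> int) : Prop :=
  exists J : {set I},
    [/\ exists i, i \in J,
        exists j, j \notin J
      & forall i j, i \in J -> j \notin J -> c i j = 0 /\ c j i = 0].

Definition irreducible : Prop := forall a, ~ decomposable (cartan C a).

Lemma sigma_alpha a i j :
  sigma a i (alpha j) = alpha j - alpha i *~ cartan C a i j.
Proof.
rewrite /sigma (bigD1 j) //= big1 ?addr0; first by rewrite ffunE eqxx mulr1z.
by move=> k kj; rewrite ffunE (negPf kj) mulr0z.
Qed.

Lemma sigmaD a i : {morph sigma a i : u v / u + v}.
Proof.
move=> u v; rewrite /sigma -big_split /=; apply: eq_bigr => k _.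
by rewrite ffunE mulrzDr.
Qed.

End CartanScheme.

(* Main.v *)
Require Import Defs.
From mathcomp Require Import all_boot all_order all_algebra finmap.
From mathcomp Require Import all_classical.
From mathcomp Require Import zify ring.
Set Implicit Arguments.
Unset Strict Implicit.
Unset Printing Implicit Defensive.
Import Order.TTheory GRing.Theory Num.Theory.
Local Open Scope ring_scope.

(* Read the simple roots at an object as the walls of a chamber. Suppose that
   c^a_ij = -n with n >= 8 and let k be the third index. Simple reflections and
   unbroken root strings produce a root l alpha_i + 2 alpha_j + alpha_k with
   l <= 4, and l <= 2 when c^a_ik = 0. The same at rho_i(a), carried back by
   the reflection, gives a root u alpha_i + 2 alpha_j + alpha_k at a with
   u - l > n. The plane containing this string through alpha_i is spanned by two
   walls of some other chamber, one of them alpha_i, so there a Cartan entry is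
   at most -(n + 1). Iterating contradicts the finiteness of the root system.
   Chambers with prescribed properties come from linear forms that vanish on no
   root: some base is positive for such a form. *)

(** * Additive maps on the root lattice *)

Lemma root_lattice_sum (I : finType) (v : root_lattice I) :
  v = \sum_j alpha j *~ v j.
Proof.
apply/ffunP => i; rewrite sum_ffunE (bigD1 i) //= big1 => [|j ji].
  by rewrite ffunMzE ffunE eqxx addr0 intz.
by rewrite ffunMzE ffunE eq_sym (negPf ji) mul0rz.
Qed.

Lemma coordD (I : finType) (u v : root_lattice I) i : (u + v) i = u i + v i :> int.
Proof. exact: ffunE. Qed.

Lemma coordN (I : finType) (v : root_lattice I) i : (- v) i = - v i :> int.
Proof. exact: ffunE. Qed.

Lemma coordMz (I : finType) (v : root_lattice I) (n : int) i :
  (v *~ n) i = v i * n :> int.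
Proof. by rewrite ffunMzE mulrzz. Qed.

Lemma additive_opp (U V : zmodType) (f : U -> V) :
  {morph f : u v / u + v} -> {morph f : u / - u}.
Proof.
move=> fD u; apply: (@addIr _ (f u)); rewrite -fD !addNr.
by apply: (@addIr _ (f 0)); rewrite -fD !add0r.
Qed.

Lemma additive_mulrz (U V : zmodType) (f : U -> V) :
  {morph f : u v / u + v} -> forall u (n : int), f (u *~ n) = f u *~ n.
Proof.
move=> fD u n.
have fMn m : f (u *+ m) = f u *+ m.
  elim: m => [|m IHm]; last by rewrite !mulrS fD IHm.
  by rewrite !mulr0n; apply: (@addIr _ (f 0)); rewrite -fD !add0r.
by case: n => n; rewrite ?NegzE ?mulrNz ?(additive_opp fD) -!pmulrn fMn.
Qed.

Lemma additive_sum (I : finType) (U : zmodType) (f : root_lattice I -> U) :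
  {morph f : u v / u + v} -> forall v, f v = \sum_j f (alpha j) *~ v j.
Proof.
move=> fD v.
have f0 : f 0 = 0 by rewrite -(mulr0z (0 : root_lattice I)) (additive_mulrz fD).
rewrite {1}[v]root_lattice_sum (big_morph f fD f0).
by apply: eq_bigr => j _; rewrite (additive_mulrz fD).
Qed.

Lemma additive_coord (I : finType) (phi : root_lattice I -> int)
    (w : root_lattice I -> root_lattice I) :
  {morph phi : u v / u + v} -> {morph w : u v / u + v} ->
  forall u, phi (w u) = \sum_l phi (w (alpha l)) * u l.
Proof.
move=> phiD wD u.
have phiwD : {morph phi \o w : u v / u + v} by move=> x y; rewrite /= wD phiD.
by rewrite [LHS](additive_sum phiwD); apply: eq_bigr => l _; rewrite mulrzz.
Qed.

(** For expanding a vector in a base: if a form is nonnegative on every term and 1 in total, a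
    single base member contributes. *)
Lemma int_sum_eq1 (J : finType) (F : J -> int) :
  (forall j, 0 <= F j) -> \sum_j F j = 1 ->
  exists2 j0, F j0 = 1 & forall j, j != j0 -> F j = 0.
Proof.
move=> F0 F1.
have [j0 Fj0] : exists j0, F j0 != 0.
  apply/existsP; apply: contraT; rewrite negb_exists => /forallP H.
  by move: F1; rewrite big1 // => j _; apply/eqP; move: (H j); rewrite negbK.
have [S0 S1] : \sum_(j | j != j0) F j = 0 /\ F j0 = 1.
  have rest_ge0 : 0 <= \sum_(j | j != j0) F j by apply: sumr_ge0.
  move/eqP: Fj0 F1 (F0 j0) rest_ge0; rewrite (bigD1 j0) //=.
  by set S := \sum_(_ | _) _; lia.
exists j0 => //.
move=> j jj0; exact: (psumr_eq0P _ S0).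
Qed.

(** * Rank three: coordinates for an ordered triple of indices *)

Definition triple (I : finType) (i j k : I) : Prop :=
  [/\ i != j, i != k, j != k & forall l, [|| l == i, l == j | l == k]].

Definition vec (I : finType) (i j k : I) (x y z : int) : root_lattice I :=
  [ffun l => if l == i then x else if l == j then y else if l == k then z else 0].

Lemma triple_ext (I : finType) (i j k : I) (u v : root_lattice I) : triple i j k ->
  u i = v i -> u j = v j -> u k = v k -> u = v.
Proof.
move=> [_ _ _ H] ? ? ?; apply/ffunP => l.
by have /or3P[/eqP->|/eqP->|/eqP->] := H l.
Qed.

Lemma triple_swap12 (I : finType) (i j k : I) : triple i j k -> triple j i k.
Proof.
by move=> [ij ik jk H]; split=> [|//|//|l]; [rewrite eq_sym|rewrite orbCA].
Qed.

Lemma triple_swap23 (I : finType) (i j k : I) : triple i j k -> triple i k j.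
Proof.
move=> [ij ik jk H]; split=> [//|//||l]; first by rewrite eq_sym.
by rewrite [X in _ || X]orbC H.
Qed.

Lemma vecE (I : finType) (i j k : I) x y z : triple i j k ->
  (vec i j k x y z i = x) * (vec i j k x y z j = y) * (vec i j k x y z k = z).
Proof.
move=> [ij ik jk _]; rewrite !ffunE !eqxx ![_ == i]eq_sym ![k == j]eq_sym.
by rewrite (negPf ij) (negPf ik) (negPf jk).
Qed.

Lemma vec_shift (I : finType) (i j k : I) x y z (n : int) : triple i j k ->
  vec i j k x y z + alpha i *~ n = vec i j k (n + x) y z.
Proof.
move=> ijk; have [ij ik _ _] := ijk.
apply: (triple_ext ijk); rewrite coordD coordMz !(vecE _ _ _ ijk) ffunE ?eqxx.
- by rewrite mul1r addrC.
- by rewrite eq_sym (negPf ij) mul0r addr0.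
- by rewrite eq_sym (negPf ik) mul0r addr0.
Qed.

Lemma sigmaE (I : finType) (A : Type) (C : cartan_scheme I A) a i v r :
  sigma C a i v r = v r - (r == i)%:R * \sum_j cartan C a i j * v j.
Proof.
rewrite /sigma sum_ffunE mulr_sumr -sumrN.
have {1}-> : v r = \sum_j (alpha j *~ v j) r.
  by rewrite -sum_ffunE -root_lattice_sum.
rewrite -big_split /=; apply: eq_bigr => j _.
rewrite !ffunMzE !ffunE !ffunMzE !ffunE.
rewrite !mulrzz; case: (r == i); case: (r == j) => /=; ring.
Qed.

(** * Simple reflections and elementary properties of roots *)

Section RootSystem.
Variables (I : finType) (A : Type) (C : cartan_scheme I A).
Hypotheses (root_system : is_root_system C (real_roots C))
  (finite : finite_roots (real_roots C)).

Local Notation R := (real_roots C).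
Local Notation c := (cartan C).
Local Notation r_ := (rho C).

Lemma sigma_neq a i v r : r != i -> sigma C a i v r = v r.
Proof. by move=> /negPf ri; rewrite sigmaE ri mul0r subr0. Qed.

Lemma cartan_diag a i : c a i i = 2.
Proof. by case: (cartan_gcm C a). Qed.

Lemma cartan_le0 a i j : i != j -> c a i j <= 0.
Proof. by case: (cartan_gcm C a) => _ + _; apply. Qed.

Lemma cartan_eq0 a i j : c a i j = 0 -> c a j i = 0.
Proof. by case: (cartan_gcm C a) => _ _; apply. Qed.

Lemma sigma_eq a i v :
  sigma C a i v i = - v i - \sum_(j | j != i) c a i j * v j.
Proof.
rewrite sigmaE eqxx mul1r (bigD1 i) //= cartan_diag.
by rewrite opprD addrA; congr (_ - _); ring.
Qed.

(** Only coordinate [i] changes, and row [i] of the Cartan matrix is the same at [a] and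
    [r_ i a]. *)
Lemma sigmaK a i : cancel (sigma C a i) (sigma C (r_ i a) i).
Proof.
move=> v; apply/ffunP => r.
have [->|ri] := eqVneq r i; last by rewrite !sigma_neq.
have eqS : \sum_(j | j != i) c (r_ i a) i j * sigma C a i v j =
    \sum_(j | j != i) c a i j * v j.
  by apply: eq_bigr => j ji; rewrite sigma_neq // -cartan_rho.
by rewrite !sigma_eq eqS opprB opprK addrAC subrr add0r.
Qed.

Lemma sigma_inj a i : injective (sigma C a i).
Proof. exact: can_inj (sigmaK a i). Qed.

Lemma alpha_root a i : R a (alpha i).
Proof. by exists a, id, i; split => //; exact: weyl_id. Qed.

Lemma root_sign a v : R a v ->
  (forall i, 0 <= v i) \/ (forall i, v i <= 0).
Proof.
case: root_system => R1 _ _ _; rewrite R1 => -[[_ v0]|[u [_ u0] <-]]; [left|right].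
  exact: v0.
by move=> i; rewrite ffunE oppr_le0; apply: u0.
Qed.

Lemma root_opp a v : R a v -> R a (- v).
Proof.
case: root_system => R1 _ _ _; rewrite R1 => -[v0|[u u0 <-]].
  by right; exists v.
by rewrite opprK; left.
Qed.

Lemma root_sigma a i v : R a v -> R (r_ i a) (sigma C a i v).
Proof. by move=> av; case: root_system => _ _ <- _; exists v. Qed.

(** Undoing the reflections one by one exhibits some [alpha j] as an [n]-th multiple, so [n] divides
    its coordinate 1. *)
Lemma root_primitive a (v : root_lattice I) (n : int) :
  R a (v *~ n) -> n = 1 \/ n = -1.
Proof.
move=> [b [w [j [bw wj]]]].
suff [u /ffunP/(_ j)] : exists u, alpha j = u *~ n.
  rewrite ffunE ffunMzE eqxx mulrzz => un.
  have : (n %| 1)%Z by apply/dvdzP; exists (u j).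
  by rewrite dvdz1; lia.
elim: bw v wj => [|d w' i _ IH] v wj; first by exists v.
apply: (IH (sigma C (r_ i d) i v)).
by rewrite -(additive_mulrz (sigmaD _ _ _)) wj /= sigmaK.
Qed.

Lemma root_neq0 a v : R a v -> v != 0.
Proof.
move=> av; apply/eqP => v0; move: av; rewrite v0 -(mulr0z (0 : root_lattice I)).
by move/root_primitive => [].
Qed.

Lemma root_bound a : exists M : int,
  forall v i, R a v -> `|v i| <= M.
Proof.
have /finite_seqP[s Rs] := finite a.
exists (\sum_(v <- s) \sum_i `|v i|) => v i; rewrite Rs /= => vs.
rewrite (big_rem v) //= (bigD1 i) //= -addrA lerDl addr_ge0 // !sumr_ge0 //.
by move=> u _; rewrite sumr_ge0.
Qed.

(** * Change of base, and bases positive for a linear form *)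

(* The properties of a morphism of the Weyl groupoid from b to a on which the
   argument relies; w maps the simple roots at b to another base of R a. *)
Definition base_change b a (w : root_lattice I -> root_lattice I) : Prop :=
  [/\ {morph w : u v / u + v}, injective w,
      forall v, R b v -> R a (w v)
    & forall v, R a v -> exists2 u, R b u & w u = v].

Lemma base_change_id a : base_change a a id.
Proof. by split=> // v; exists v. Qed.

Lemma base_change_comp a b d w w' :
  base_change b a w -> base_change d b w' -> base_change d a (w \o w').
Proof.
move=> [wD w_inj wR wS] [w'D w'_inj w'R w'S]; split.
- by move=> u v; rewrite /= w'D wD.
- exact: inj_comp.
- by move=> v /w'R/wR.
- by move=> v /wS[u /w'S[x dx <-] <-]; exists x.
Qed.

Lemma base_change_sigma b i : base_change (r_ i b) b (sigma C (r_ i b) i).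
Proof.
split; [exact: sigmaD|exact: sigma_inj| |].
  by move=> v /(root_sigma i); rewrite rhoK.
by move=> v bv; exists (sigma C b i v); [exact: root_sigma|exact: sigmaK].
Qed.

(* Reflecting in a simple root on which phi is negative removes exactly that
   root from the set of positive roots with negative phi. *)
Lemma dominant_base a (phi : root_lattice I -> int) :
  {morph phi : u v / u + v} -> (forall v, R a v -> phi v != 0) ->
  exists b w, [/\ base_change b a w, forall j, 0 < phi (w (alpha j))
    & forall u, R b u -> 0 < phi (w u) -> forall i, 0 <= u i].
Proof.
move=> phiD phi0.
suff [b [w [bw w_pos]]] :
    exists b w, base_change b a w /\ forall j, 0 < phi (w (alpha j)).
  exists b, w; split=> // u bu; have [//|u_neg] := root_sign bu.
  have [wD _ _ _] := bw.
  rewrite (additive_coord phiD wD) ltNge sumr_le0 // => l _.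
  by rewrite mulr_ge0_le0 // ltW.
have /finite_seqP[s Rs] := finite a.
(* Images in [R a] are counted, so that all bases are measured along the same list [s]. *)
pose bad b w v :=
  (phi v < 0) && `[< exists u, [/\ R b u, forall i, 0 <= u i & w u = v] >].
suff H n : forall b w, base_change b a w -> (count (bad b w) s < n)%N ->
    exists b w, base_change b a w /\ forall j, 0 < phi (w (alpha j)).
  exact: (H _ a id (base_change_id a) (ltnSn _)).
elim: n => // n IHn b w bw; rewrite ltnS => le_n.
have [wD w_inj wR _] := bw.
have [H|/existsNP[j /negP]] := pselect (forall j, 0 < phi (w (alpha j))).
  by exists b, w.
rewrite -leNgt le_eqVlt (negPf (phi0 _ (wR _ (alpha_root b j)))) /= => phi_j.
pose b' := r_ j b; pose w' := w \o sigma C b' j.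
apply: (IHn b' w'); first exact/base_change_comp/base_change_sigma.
apply: leq_trans le_n.
have wj_s : w (alpha j) \in s by have := wR _ (alpha_root b j); rewrite Rs.
(* [w'] sends [alpha j] to [- w (alpha j)], where [phi] is positive, so [u] is no multiple of
   [alpha j]. Another coordinate is positive, and the reflection keeps it. *)
have sigma_ge0 u : R b' u -> (forall i, 0 <= u i) -> phi (w' u) < 0 ->
    (exists2 r, r != j & 0 < u r) /\ forall i, 0 <= sigma C b' j u i.
  move=> bu u0 phi_u.
  have [r rj ur] : exists2 r, r != j & 0 < u r.
    apply: contrapT => /forall2NP H.
    have uj : u = alpha j *~ u j.
      rewrite {1}[u]root_lattice_sum (bigD1 j) //= big1 ?addr0 // => i ij.
      have [/negP|/negP] := H i; first by rewrite ij.
      rewrite -leNgt => ui; rewrite (_ : u i = 0) ?mulr0z //.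
      by move: (u0 i); lia.
    have uj1 : u j = 1.
      have := bu; rewrite {1}uj => /root_primitive[//|uj1].
      by have := u0 j; rewrite uj1.
    move: phi_u; rewrite uj uj1 mulr1z /w' /= sigma_alpha cartan_diag.
    rewrite (_ : 2 = 1 + 1) // mulrzDr !mulr1z opprD addNKr.
    by rewrite (additive_opp wD) (additive_opp phiD); lia.
  split; first by exists r.
  have /root_sign[//|H] : R b (sigma C b' j u).
    by rewrite -{1}[b](rhoK C j); apply: root_sigma.
  by have := H r; rewrite sigma_neq //; lia.
have disjoint : count (predI (bad b' w') (pred1 (w (alpha j)))) s = 0%N.
  apply/eqP; rewrite -leqn0 leqNgt -has_count; apply/negP => /hasP[v _ /=].
  move=> /andP[/andP[phi_v /asboolP[u [bu u0 uv]]] /eqP vj].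
  have [|[r rj ur] _] := sigma_ge0 u bu u0; first by rewrite uv.
  have /w_inj/ffunP/(_ r) : w (sigma C b' j u) = w (alpha j) by rewrite [LHS]uv.
  by rewrite sigma_neq // ffunE (negPf rj); lia.
have le_bad : (count (predU (bad b' w') (pred1 (w (alpha j)))) s <=
    count (bad b w) s)%N.
  apply: sub_count => v /= /orP[/andP[phi_v /asboolP[u [bu u0 uv]]]|/eqP ->].
    rewrite /bad phi_v /=; apply/asboolP; exists (sigma C b' j u); split=> //.
      by rewrite -{1}[b](rhoK C j); apply: root_sigma.
    by have [|_ +] := sigma_ge0 u bu u0; rewrite // uv.
  rewrite /bad phi_j /=; apply/asboolP; exists (alpha j); split=> //.
    exact: alpha_root.
  by move=> i; rewrite ffunE; case: eqP.
apply: leq_trans le_bad.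
rewrite -[leqRHS]addn0 -disjoint count_predUI -addn1 leq_add2l.
by rewrite -has_count has_pred1.
Qed.

(** [alpha i] is a nonnegative combination of the new base, on which [phi] takes positive integer
    values; a total of 1 leaves one member with coefficient 1. *)
Lemma dominant_base_simple a (phi : root_lattice I -> int) i :
  {morph phi : u v / u + v} -> (forall v, R a v -> phi v != 0) ->
  phi (alpha i) = 1 ->
  exists b w l0, [/\ base_change b a w, forall j, 0 < phi (w (alpha j)),
    forall u, R b u -> 0 < phi (w u) -> forall l, 0 <= u l
    & w (alpha l0) = alpha i].
Proof.
move=> phiD phi0 phi_i.
have [b [w [bw w_pos w_sign]]] := dominant_base phiD phi0.
have [wD _ _ wS] := bw; have [u bu wu] := wS _ (alpha_root a i).
have u_ge0 : forall l, 0 <= u l by apply: w_sign; rewrite // wu phi_i.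
have [l0 ul0 u_neq] : exists2 l0, phi (w (alpha l0)) * u l0 = 1 &
    forall l, l != l0 -> phi (w (alpha l)) * u l = 0.
  apply: int_sum_eq1 => [l|]; first by rewrite mulr_ge0 // ltW.
  by rewrite -(additive_coord phiD wD) wu.
exists b, w, l0; split=> //; rewrite -wu; congr w; apply/ffunP => l; rewrite ffunE.
have [->|/u_neq/eqP] := eqVneq l l0; last first.
  by rewrite mulf_eq0 (gt_eqF (w_pos l)) => /eqP.
have : (u l0 %| 1)%Z by apply/dvdzP; exists (phi (w (alpha l0))).
by rewrite dvdz1; have := u_ge0 l0; lia.
Qed.

(** * Root strings and the Cartan entries they force *)

(* If v, the vector strictly between, were no root, choose phi with phi v = 0
   and phi (alpha i) = 1 that vanishes on no root. In a base positive for phi,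
   alpha i is simple, and the end of the string below v is a negative root and
   that above v a positive one, so both are multiples of alpha i. *)
Lemma root_string a i j k (y s t s' : int) :
  triple i j k -> s <= t <= s' ->
  R a (vec i j k s y 1) -> R a (vec i j k s' y 1) -> R a (vec i j k t y 1).
Proof.
move=> ijk /andP[].
rewrite !le_eqVlt => /orP[/eqP->//|st] /orP[/eqP->//|ts'] as1 as2.
apply: contrapT => not_root.
have vE := vecE _ _ _ ijk.
have [M boundM] := root_bound a.
(* The weight exceeds [|v i - t * v k|] for every root [v], so [phi v = 0] makes both summands
   vanish and [v] a multiple of the missing vector. *)
pose phi (v : root_lattice I) :=
  (v i - t * v k) + (M + `|t| * M + 1) * (v j - y * v k).
have phiD : {morph phi : u v / u + v} by move=> u v; rewrite /phi !coordD; ring.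
have phi0 v : R a v -> phi v != 0.
  move=> av; apply/eqP => phi_v.
  have [vi vk] := (boundM v i av, boundM v k av).
  have tvk : `|t * v k| <= `|t| * M by rewrite normrM ler_wpM2l.
  have vj : v j - y * v k = 0.
    move: phi_v; rewrite /phi.
    set X := _ - y * _; set B := `|t| * M in tvk *.
    have : `|v i - t * v k| < M + B + 1 by lia.
    by set Y := v i - _; nia.
  have v_vec : v = vec i j k t y 1 *~ v k.
    apply: (triple_ext ijk); rewrite coordMz vE; last by ring.
      by move: phi_v; rewrite /phi vj; lia.
    by lia.
  have := av; rewrite v_vec => /root_primitive vk1; apply: not_root.
  move: av; rewrite v_vec; case: vk1 => ->; first by rewrite mulr1z.
  by move/root_opp; rewrite mulrN1z opprK.
have [ij ik jk _] := ijk.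
have phi_i : phi (alpha i) = 1.
  by rewrite /phi !ffunE eqxx ![_ == i]eq_sym (negPf ij) (negPf ik); lia.
have [b [w [l0 [[wD w_inj wR wS] w_pos w_sign wl0]]]] :=
  dominant_base_simple phiD phi0 phi_i.
have [u2 bu2 wu2] := wS _ as1.
have [u3 bu3 wu3] := wS _ as2.
have u3_ge0 : forall l, 0 <= u3 l.
  by apply: w_sign => //; rewrite wu3 /phi !vE; lia.
have u2_le0 l : u2 l <= 0.
  have := w_sign _ (root_opp bu2).
  rewrite (additive_opp wD) (additive_opp phiD) wu2 /phi !vE => /(_ _ l).
  by rewrite coordN oppr_ge0; apply; lia.
have wMz := additive_mulrz wD.
have u32 : u3 = u2 + alpha l0 *~ (s' - s).
  by apply: w_inj; rewrite wD wMz wl0 wu2 wu3 vec_shift // subrK.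
have u2E : u2 = alpha l0 *~ u2 l0.
  apply/ffunP => l; rewrite coordMz ffunE.
  have [->|ll0] := eqVneq l l0; first by rewrite mul1r.
  rewrite mul0r; apply/le_anti; rewrite u2_le0 /=.
  by have := u3_ge0 l; rewrite u32 coordD coordMz ffunE (negPf ll0) mul0r addr0.
have /ffunP/(_ k) : w u2 = alpha i *~ u2 l0 by rewrite {1}u2E wMz wl0.
by rewrite wu2 vE coordMz ffunE eq_sym (negPf ik) mul0r.
Qed.

(** A suitable base contains [alpha i] and a second member in the plane of the string; each end is
    that member plus a nonnegative multiple of [alpha i]. Reflecting the upper end in [alpha i]
    keeps the coefficient 1 of the second member, so the result is positive, and this bounds the
    entry. *)
Lemma localize_string a i j k (s s' : int) :
  triple i j k -> 0 <= s -> s <= s' ->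
  R a (vec i j k s 2 1) -> R a (vec i j k s' 2 1) ->
  exists b w i' j', [/\ base_change b a w, i' != j' & c b i' j' <= s - s'].
Proof.
move=> ijk s0 ss' as1 as2.
have vE := vecE _ _ _ ijk.
have [M boundM] := root_bound a.
have [ij ik jk _] := ijk.
have M1 : 1 <= M by have := boundM _ i (alpha_root a i); rewrite ffunE eqxx; lia.
(* Large enough that [N * N > M + N * M] and [N > M]: lower terms of [phi] never outweigh a higher
   one. *)
pose N := M + 2.
(* Lexicographic: first the form vanishing on the plane of the string, then one
   vanishing on [alpha i], then the coordinate along [alpha i]. *)
pose phi (v : root_lattice I) := v i + N * v k + N * N * (v j - 2 * v k).
have phiD : {morph phi : u v / u + v} by move=> u v; rewrite /phi !coordD; ring.
(* In the names below, f is the form [v j - 2 * v k] that cuts out the plane of the string. *)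
have f_ge0 v : R a v -> 0 <= phi v -> 0 <= v j - 2 * v k.
  move=> av; have [vi vk] := (boundM v i av, boundM v k av).
  move=> phi_v; rewrite leNgt; apply/negP => f_lt0.
  have : N * N * (v j - 2 * v k) <= N * N * (-1) by rewrite ler_wpM2l //; lia.
  have : N * v k <= N * M by rewrite ler_wpM2l //; lia.
  have : N * N = N * M + 2 * N by rewrite /N; ring.
  have : N = M + 2 by [].
  by move: phi_v; rewrite /phi; lia.
have k_ge0 v : R a v -> 0 <= phi v -> v j - 2 * v k = 0 -> 0 <= v k.
  move=> av phi_v f0; have vi := boundM v i av.
  by move: phi_v; rewrite /phi f0 /N; nia.
have phi0 v : R a v -> phi v != 0.
  move=> av; apply/eqP => phi_v.
  have f0 : v j - 2 * v k = 0.
    have := f_ge0 _ av; have := f_ge0 _ (root_opp av).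
    rewrite (additive_opp phiD) phi_v oppr0 lexx !coordN.
    by move=> /(_ isT) + /(_ isT); lia.
  have vk : v k = 0.
    have := k_ge0 _ av; have := k_ge0 _ (root_opp av).
    rewrite (additive_opp phiD) phi_v oppr0 lexx !coordN.
    by move=> /(_ isT) + /(_ isT); lia.
  have /eqP := root_neq0 av; apply; apply: (triple_ext ijk); rewrite ffunE //.
    by move: phi_v; rewrite /phi f0 vk; lia.
  by lia.
have phi_i : phi (alpha i) = 1.
  by rewrite /phi !ffunE eqxx ![_ == i]eq_sym (negPf ij) (negPf ik); lia.
have [b [w [l0 [bw w_pos w_sign wl0]]]] := dominant_base_simple phiD phi0 phi_i.
have [wD w_inj wR wS] := bw; have wMz := additive_mulrz wD.
have [u2 bu2 wu2] := wS _ as1.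
have [u3 bu3 wu3] := wS _ as2.
have u2_ge0 : forall l, 0 <= u2 l.
  by apply: w_sign => //; rewrite wu2 /phi !vE /N; lia.
pose g l := w (alpha l).
have gR l : R a (g l) by apply/wR/alpha_root.
have g_pos l : 0 <= phi (g l) by apply/ltW/w_pos.
have evalD x : {morph (fun v : root_lattice I => v x) : u v / u + v}.
  by move=> u v; exact: coordD.
have coord x u : w u x = \sum_l g l x * u l.
  exact: (additive_coord (evalD x) wD).
(* f vanishes on the string and is nonnegative on the base, so [u2] involves only base members in
   the plane. *)
have f_term l : (g l j - 2 * g l k) * u2 l = 0.
  have term_ge0 l' : true -> 0 <= (g l' j - 2 * g l' k) * u2 l'.
    by move=> _; rewrite mulr_ge0 // f_ge0.
  apply: (psumr_eq0P term_ge0) => //.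
  have : w u2 j - 2 * w u2 k = 0 by rewrite wu2 !vE.
  rewrite !coord mulr_sumr -sumrB => E; rewrite -[RHS]E.
  by apply: eq_bigr => l' _; ring.
have [l1 l1_eq l1_neq] : exists2 l1, g l1 k * u2 l1 = 1 &
    forall l, l != l1 -> g l k * u2 l = 0.
  apply: int_sum_eq1 => [l|]; last by rewrite -coord wu2 vE.
  have /eqP := f_term l; rewrite mulf_eq0 => /orP[/eqP f0|/eqP->]; last first.
    by rewrite mulr0.
  by rewrite mulr_ge0 // k_ge0.
have l10 : l1 != l0.
  apply/eqP => l10; move: l1_eq.
  by rewrite l10 /g wl0 ffunE eq_sym (negPf ik) mul0r.
have u2_l1 : u2 l1 = 1.
  have : (u2 l1 %| 1)%Z by apply/dvdzP; exists (g l1 k).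
  by rewrite dvdz1; have := u2_ge0 l1; lia.
(* A further member occurring in [u2] would be a multiple of [alpha i], which is already the image
   of [alpha l0]. *)
have u2_neq l : l != l0 -> l != l1 -> u2 l = 0.
  move=> ll0 ll1; apply/eqP; apply: contraT => u2l.
  have gk : g l k = 0.
    by have /eqP := l1_neq l ll1; rewrite mulf_eq0 (negPf u2l) orbF => /eqP.
  have gj : g l j = 0.
    by have /eqP := f_term l; rewrite mulf_eq0 (negPf u2l) orbF gk => /eqP; lia.
  have /w_inj/ffunP/(_ l) : w (alpha l) = w (alpha l0 *~ g l i).
    rewrite wMz wl0; apply: (triple_ext ijk); rewrite coordMz ffunE.
    - by rewrite eqxx mul1r.
    - by rewrite eq_sym (negPf ij) mul0r.
    - by rewrite eq_sym (negPf ik) mul0r.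
  by rewrite coordMz !ffunE eqxx (negPf ll0) mul0r.
have u32 : u3 = u2 + alpha l0 *~ (s' - s).
  by apply: w_inj; rewrite wD wMz wl0 wu2 wu3 vec_shift // subrK.
have u3_neq l : l != l0 -> u3 l = u2 l.
  by move=> ll0; rewrite u32 coordD coordMz ffunE (negPf ll0) mul0r addr0.
exists b, w, l0, l1; split => //; first by rewrite eq_sym.
have refl_ge0 : 0 <= sigma C b l0 u3 l0.
  have [//|/(_ l1)] := root_sign (root_sigma l0 bu3).
  by rewrite sigma_neq // u3_neq // u2_l1.
move: refl_ge0; rewrite sigma_eq (bigD1 l1) //=.
rewrite big1 ?addr0 => [|l /andP[ll0 ll1]]; last first.
  by rewrite u3_neq // u2_neq // mulr0.
rewrite (u3_neq l1) // u2_l1 u32 coordD coordMz ffunE eqxx.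
by have := u2_ge0 l0; lia.
Qed.

(** * Reflections in coordinates *)

Lemma vec_swap12 (i j k : I) x y z : triple i j k ->
  vec j i k y x z = vec i j k x y z.
Proof.
by move=> ijk; apply: (triple_ext ijk);
  rewrite !(vecE _ _ _ ijk) !(vecE _ _ _ (triple_swap12 ijk)).
Qed.

Lemma vec_swap23 (i j k : I) x y z : triple i j k ->
  vec i k j x z y = vec i j k x y z.
Proof.
by move=> ijk; apply: (triple_ext ijk);
  rewrite !(vecE _ _ _ ijk) !(vecE _ _ _ (triple_swap23 ijk)).
Qed.

Lemma alpha_vec (i j k : I) : triple i j k -> alpha k = vec i j k 0 0 1.
Proof.
move=> ijk; have [ij ik jk _] := ijk.
apply: (triple_ext ijk); rewrite !(vecE _ _ _ ijk) ffunE ?eqxx //.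
  by rewrite (negPf ik).
by rewrite (negPf jk).
Qed.

Lemma root_vec_sign a i j k x y z : triple i j k -> R a (vec i j k x y z) ->
  [/\ 0 <= x, 0 <= y & 0 <= z] \/ [/\ x <= 0, y <= 0 & z <= 0].
Proof.
move=> ijk /root_sign[] H; [left|right]; split.
- by have := H i; rewrite (vecE _ _ _ ijk).
- by have := H j; rewrite (vecE _ _ _ ijk).
- by have := H k; rewrite (vecE _ _ _ ijk).
- by have := H i; rewrite (vecE _ _ _ ijk).
- by have := H j; rewrite (vecE _ _ _ ijk).
- by have := H k; rewrite (vecE _ _ _ ijk).
Qed.

Lemma root_vec_reflect1 a i j k x y z : triple i j k -> R a (vec i j k x y z) ->
  R (r_ i a) (vec i j k (- x - c a i j * y - c a i k * z) y z).
Proof.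
move=> ijk /(root_sigma i); set u := sigma _ _ _ _; set v := vec _ _ _ _ _ _.
suff -> : u = v by [].
have [ij ik jk H] := ijk.
apply: (triple_ext ijk); rewrite /u /v !(vecE _ _ _ ijk).
- rewrite sigma_eq (bigD1 j) 1?eq_sym //= (bigD1 k) /= ?[k == _]eq_sym ?ik // big1.
    by rewrite !(vecE _ _ _ ijk) addr0 opprD addrA.
  move=> l /andP[/andP[li lj] lk]; have := H l.
  by rewrite (negPf li) (negPf lj) (negPf lk).
- by rewrite sigma_neq 1?eq_sym // (vecE _ _ _ ijk).
- by rewrite sigma_neq 1?eq_sym // (vecE _ _ _ ijk).
Qed.

Lemma root_vec_reflect2 a i j k x y z : triple i j k -> R a (vec i j k x y z) ->
  R (r_ j a) (vec i j k x (- y - c a j i * x - c a j k * z) z).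
Proof.
move=> ijk; rewrite -!(vec_swap12 _ _ _ ijk).
exact/root_vec_reflect1/triple_swap12.
Qed.

(** The ends are [alpha k] and the reflection of [alpha k] from [r_ i a]. *)
Lemma root_simple_string a i j k t : triple i j k -> 0 <= t <= - c a i k ->
  R a (vec i j k t 0 1).
Proof.
move=> ijk /root_string; apply => //.
  by rewrite -alpha_vec //; exact: alpha_root.
have := alpha_root (r_ i a) k; rewrite (alpha_vec ijk) => /(root_vec_reflect1 ijk).
by rewrite rhoK -!cartan_rho mulr0 mulr1 !subr0 oppr0 sub0r.
Qed.

(** * Irreducibility and roots with small coefficients *)

Hypothesis irr : irreducible C.

Lemma cartan_lt0 a i j : i != j -> c a i j < 0 -> c a j i < 0.
Proof.
rewrite eq_sym => ji /ltr0_neq0 cij; rewrite lt_neqAle cartan_le0 // andbT.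
by apply/eqP => /cartan_eq0 c0; rewrite c0 in cij.
Qed.

(** If [c a i k] vanished too, [i] would split off; the same holds for [j]. *)
Lemma cartan_connected a i j k : triple i j k -> c a i j = 0 ->
  [/\ c a i k < 0, c a k i < 0, c a j k < 0 & c a k j < 0].
Proof.
have H i' j' k' : triple i' j' k' -> c a i' j' = 0 -> c a i' k' < 0.
  move=> ijk cij; have [ij ik jk I3] := ijk.
  rewrite lt_neqAle cartan_le0 // andbT.
  apply: contra_notN (irr (a := a)) => /eqP cik.
  exists [set i']; split.
  - by exists i'; rewrite inE.
  - by exists j'; rewrite inE eq_sym.
  - move=> i1 j1; rewrite !inE => /eqP -> j1i.
    have /or3P[/eqP E|/eqP->|/eqP->] := I3 j1; first by rewrite E eqxx in j1i.
      by split=> //; apply: cartan_eq0.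
    by split=> //; apply: cartan_eq0.
move=> ijk cij; have [_ ik jk _] := ijk.
have cik := H _ _ _ ijk cij.
have cjk := H _ _ _ (triple_swap12 ijk) (cartan_eq0 cij).
by split=> //; apply: cartan_lt0.
Qed.

Lemma root_pair a i j k : triple i j k -> c a j k < 0 -> R a (vec i j k 0 1 1).
Proof.
move=> ijk cjk; rewrite -(vec_swap12 _ _ _ ijk).
by apply: root_simple_string; [exact: triple_swap12|lia].
Qed.

(** If [c a i k = 0], irreducibility makes [alpha j + alpha k] a root at [a] and at [r_ i a]; its
    reflection from there ends a string through the sum. Another zero entry is a renaming of this
    case. *)
Lemma root_sum a i j k : triple i j k -> R a (vec i j k 1 1 1).
Proof.
have H b i' j' k' : triple i' j' k' -> c b i' k' = 0 -> R b (vec i' j' k' 1 1 1).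
  move=> ijk cik; have ikj := triple_swap23 ijk; have [ij ik jk _] := ijk.
  have cik' : c (r_ i' b) i' k' = 0 by rewrite -cartan_rho.
  have [cij _ _ cjk] := cartan_connected ikj cik.
  have [_ _ _ cjk'] := cartan_connected ikj cik'.
  have := root_pair ijk cjk' => /(root_vec_reflect1 ijk).
  rewrite rhoK -!cartan_rho cik mulr1 mul0r oppr0 sub0r subr0.
  by apply: root_string (root_pair ijk cjk) => //; lia.
move=> ijk; have [ij ik jk _] := ijk.
have [/H|cik] := eqVneq (c a i k) 0; first exact.
have [cij|cij] := eqVneq (c a i j) 0.
  by rewrite -(vec_swap23 _ _ _ ijk); apply: H => //; exact: triple_swap23.
have [cjk|cjk] := eqVneq (c a j k) 0.
  by rewrite -(vec_swap12 _ _ _ ijk); apply: H => //; exact: triple_swap12.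
have [lij lik ljk] := And3 (cartan_le0 a ij) (cartan_le0 a ik) (cartan_le0 a jk).
have bottom : R a (vec i j k 0 1 1) by apply: root_pair => //; lia.
(* With no zero entry at [a], the reflected root has [alpha i]-coefficient at least 1 in both
   cases. *)
have [cjk'|cjk'] := eqVneq (c (r_ i a) j k) 0.
  have : R (r_ i a) (vec i j k 1 1 1).
    by rewrite -(vec_swap12 _ _ _ ijk); apply: H => //; exact: triple_swap12.
  move/(root_vec_reflect1 ijk); rewrite rhoK -!cartan_rho !mulr1.
  by apply: (root_string ijk _ bottom); lia.
have ljk' := cartan_le0 (r_ i a) jk.
have : R (r_ i a) (vec i j k 0 1 1) by apply: root_pair => //; lia.
move/(root_vec_reflect1 ijk); rewrite rhoK -!cartan_rho !mulr1.
by apply: (root_string ijk _ bottom); lia.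
Qed.

(** The boolean corrections replace [alpha j + alpha k] by the sum of all simple roots where [j] and
    [k] are not joined. The upper end is reflected from [r_ i a]. *)
Lemma root_pair_string a i j k t : triple i j k ->
  (c a j k == 0)%:Z <= t <= - c a i j - c a i k - (c (r_ i a) j k == 0)%:Z ->
  R a (vec i j k t 1 1).
Proof.
move=> ijk; have [ij ik jk _] := ijk.
have bottom b : R b (vec i j k (c b j k == 0)%:Z 1 1).
  have [_|cjk] := eqVneq (c b j k) 0; first exact: root_sum.
  by apply: root_pair => //; rewrite lt_neqAle cjk cartan_le0.
move/root_string; apply=> //.
have := bottom (r_ i a) => /(root_vec_reflect1 ijk).
rewrite rhoK -!cartan_rho !mulr1; congr (R a (vec _ _ _ _ _ _)); ring.
Qed.

(* Consecutive entries 1, 1 (resp. 1, 2, 1) around a rank two vertex would make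
   it of type A2 (resp. B2), with no entry below -2. *)
Lemma cartan_next a i j k : triple i j k -> c a i j <= -3 -> c a j i = -1 ->
  c (r_ j a) i j <= -2 /\
  (c (r_ j a) i j = -2 -> c (r_ i (r_ j a)) j i <= -2).
Proof.
move=> ijk cij cji.
have kij : triple k i j by apply/triple_swap12/triple_swap23.
(* With [m = - c a i j], [alpha j] passes through [(m, 1)] and [(m, m - 1)]; the next two
   reflections must keep coordinates nonnegative. *)
have : R (r_ i a) (vec i j k 0 1 0).
  rewrite -(vec_swap23 _ _ _ ijk) -alpha_vec; last exact: triple_swap23.
  exact: alpha_root.
move/(root_vec_reflect1 ijk); rewrite rhoK -!cartan_rho.
move/(root_vec_reflect2 ijk)/(root_vec_reflect1 ijk); rewrite cji => root_e.
have cij' : c (r_ j a) i j <= -2.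
  have := root_vec_sign ijk root_e; move: cij root_e.
  set x := c a i j; set y := c (r_ j a) i j => cij _.
  by case=> -[]; nia.
split=> // cij'2; have := root_vec_reflect2 ijk root_e => /(root_vec_sign ijk).
rewrite cij'2; set x := c a i j in cij *; set y := c _ j i.
by case=> -[]; nia.
Qed.

(** Unless [c a j k <= -2], the root is found at [r_ j a] and reflected back. The hard case is
    [c a j i = -1], where [cartan_next] supplies entries negative enough for the strings there. *)
Lemma low_root a i j k : triple i j k -> c a i j <= -3 ->
  exists2 l, [/\ 0 <= l, l <= 4 & c a i k = 0 -> l <= 2] & R a (vec i j k l 2 1).
Proof.
move=> ijk cij; have [ij ik jk _] := ijk; have jik := triple_swap12 ijk.
have ikj := triple_swap23 ijk; have jki := triple_swap23 jik.
have cji : c a j i < 0 by apply: cartan_lt0 => //; lia.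
have ljk := cartan_le0 a jk.
have [q2|] := leP (c a j k) (-2).
  exists 0 => //; rewrite -(vec_swap12 _ _ _ ijk).
  by apply: root_simple_string => //; lia.
set b := r_ j a.
have cbji : c b j i = c a j i by rewrite -cartan_rho.
have cbjk : c b j k = c a j k by rewrite -cartan_rho.
(* [t] is the coefficient that the reflection turns into 2. *)
have reflect l t : t = - 2 - c a j i * l - c a j k ->
    R b (vec i j k l t 1) -> R a (vec i j k l 2 1).
  move=> -> /(root_vec_reflect2 ijk); rewrite rhoK cbji cbjk.
  by congr (R a (vec _ _ _ _ _ _)); ring.
have row t : (c b i k == 0)%:Z <= t <= - c a j i - c a j k - (c a i k == 0)%:Z ->
    R b (vec i j k 1 t 1).
  move=> t_in; rewrite -(vec_swap12 _ _ _ ijk); apply: root_pair_string => //.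
  by rewrite cbji cbjk rhoK.
have lbik := cartan_le0 b ik.
have next : c a j i = -1 -> c b i j <= -2 /\ (c b i j = -2 -> c (r_ i b) j i <= -2).
  exact: (cartan_next ijk cij).
(* Only when [c a j k = 0] can [l] exceed 2, and then irreducibility excludes [c a i k = 0]. *)
move=> q1; have [cjk|cjk] := eqVneq (c a j k) 0.
  have [_ _ _ caik] := cartan_connected jki cjk.
  have [_ _ _ cbik] := cartan_connected jki (etrans cbjk cjk).
  rewrite cjk (lt_eqF caik) (lt_eqF cbik) in row reflect.
  have [cji2|cji1] := leP (c a j i) (-2).
    exists 1; first by split; lia.
    by apply: (reflect 1 (- 2 - c a j i)); [lia|apply: row; lia].
  have cji_eq : c a j i = -1 by lia.
  have [cbik2|cbik1] := leP (c b i k) (-2).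
    exists 2; first by split; lia.
    by apply: (reflect 2 0); [rewrite cji_eq|apply: (root_simple_string ijk); lia].
  have [cbij next_e] := next cji_eq.
  pose e := r_ i b.
  have [top|/norP[]] := boolP ((c b i j <= -3) || (c e j k != 0)).
    exists 3; first by split; lia.
    apply: (reflect 3 1); first by rewrite cji_eq.
    apply: root_pair_string => //; rewrite cbjk cjk -/e /=.
    by case/orP: top => [cbij3|/negPf ->] /=; [case: eqP|]; lia.
  (* All relevant entries are now known, and the root is reflected from [e], one chamber further. *)
  rewrite -ltNge negbK => cbij3 /eqP cejk.
  exists 4; first by split; lia.
  apply: (reflect 4 2); first by rewrite cji_eq.
  have ceij : c e i j = -2 by rewrite -cartan_rho; lia.
  have ceik : c e i k = -1 by rewrite -cartan_rho; lia.
  have root_e : R e (vec i j k 1 2 1).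
    rewrite -(vec_swap12 _ _ _ ijk); apply: root_pair_string => //.
    have cejk' : c (r_ j e) j k = 0 by rewrite -cartan_rho.
    have [_ _ _ ceik'] := cartan_connected jki cejk'.
    have : c e j i <= -2 by apply: next_e; lia.
    by rewrite ceik cejk (lt_eqF ceik') /=; lia.
  have := root_vec_reflect1 ijk root_e; rewrite rhoK ceij ceik.
  by congr (R b (vec _ _ _ _ _ _)).
have cjk1 : c a j k = -1 by lia.
have [cji2|cji1] := leP (c a j i) (-2).
  exists 1; first by split; lia.
  apply: (reflect 1 (- 1 - c a j i)); first by lia.
  by apply: row; case: eqP; case: eqP; lia.
have cji_eq : c a j i = -1 by lia.
have [cbik|cbik] := eqVneq (c b i k) 0; last first.
  exists 1; first by split; lia.
  apply: (reflect 1 0); first by lia.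
  by apply: row; rewrite (negPf cbik); case: eqP; lia.
exists 2; first by split; lia.
apply: (reflect 2 1); first by lia.
apply: root_pair_string => //; rewrite cbjk cjk1 cbik /=.
have [_ _ _ cjk'] := cartan_connected ikj (etrans (esym (cartan_rho C b i k)) cbik).
have [cbij _] := next cji_eq.
by rewrite (lt_eqF cjk') /=; lia.
Qed.

(** * Unbounded growth of the Cartan entries *)

(** With [n = - c a i j], the string has length at least [2n + 1 - 4 - 4] if [c a i k < 0] and
    [2n - 2 - 2] otherwise; [n >= 8] is what makes [2n - 7 >= n + 1]. *)
Lemma lower_entry a i j k : triple i j k -> c a i j <= -8 ->
  exists b w i' j', [/\ base_change b a w, i' != j' & c b i' j' <= c a i j - 1].
Proof.
move=> ijk cij; have [ij ik jk _] := ijk.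
have [|l [l0 l4 l2] root_l] := low_root (a := a) ijk; first by lia.
have [|l' [l'0 l'4 l'2] root_l'] := low_root (a := r_ i a) ijk.
  by rewrite -cartan_rho; lia.
rewrite -cartan_rho in l'2.
have := root_vec_reflect1 ijk root_l'; rewrite rhoK -!cartan_rho mulr1.
set u := _ - _ => root_u.
have cik := cartan_le0 a ik.
have l_l' : l - u <= c a i j - 1.
  rewrite /u; have [/[dup] /l2 ? /l'2 ?|/eqP] := eqVneq (c a i k) 0; lia.
have [|b [w [i' [j' [bw i'j' cb]]]]] :=
  localize_string ijk l0 _ root_l root_u; first by lia.
by exists b, w, i', j'; split=> //; apply: le_trans l_l'.
Qed.

End RootSystem.

Lemma triple_exists (I : finType) (i j : I) :
  #|I| = 3%N -> i != j -> exists k, triple i j k.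
Proof.
move=> I3 ij; have := cardsC [set i; j]; rewrite cards2 ij I3 => -[].
move=> /eqP/cards1P[k Ek]; exists k.
have H l : (l \notin [set i; j]) = (l == k) by rewrite -finset.in_setC Ek inE.
have := H k; rewrite eqxx !inE negb_or => /andP[ki kj].
split=> //; rewrite 1?eq_sym // => l.
by have := H l; rewrite !inE; case: (l == i); case: (l == j) => //= <-.
Qed.

Theorem theorem3p13 (I : finType) (A : Type) (C : cartan_scheme I A)
  (rank_three : rank C = 3%N)
  (root_system : is_root_system C (real_roots C))
  (finite : finite_roots (real_roots C))
  (irr : irreducible C) :
  forall (a : A) (i j : I), -7 <= cartan C a i j.
Proof.
move=> a i j; rewrite leNgt; apply/negP => cij.
have unbounded (n : nat) : exists b w i' j',
    [/\ base_change C b a w, i' != j' & cartan C b i' j' <= - 8 - n%:Z].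
  elim: n => [|n [b [w [i1 [j1 [bw ij1 cb]]]]]].
    exists a, id, i, j; split; [exact: base_change_id| |by lia].
    by apply: contraL cij => /eqP ->; rewrite cartan_diag.
  have [k ijk] := triple_exists rank_three ij1.
  have [|d [w' [i2 [j2 [dw ij2 cd]]]]] :=
    lower_entry root_system finite irr ijk (a := b).
    by lia.
  by exists d, (w \o w'), i2, j2; split=> //; [exact: base_change_comp dw|lia].
have [M boundM] := root_bound finite a.
(* Two roots at [a] differ by at most [2 * M] in each coordinate. The images of [alpha j1] and of
   its reflection differ by a larger multiple of [w (alpha i1)], which must then vanish. *)
have [b [w [i1 [j1 [[wD _ wR _] ij1 cb]]]]] := unbounded (absz (2 * M)).
have root1 := alpha_root C b i1; have root2 := alpha_root C b j1.
have root3 := root_sigma root_system i1 (alpha_root C (rho C i1 b) j1).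
rewrite rhoK sigma_alpha -cartan_rho in root3.
have /eqP w1 := root_neq0 (wR _ root1).
apply: w1; apply/ffunP => l; rewrite ffunE; apply/eqP; apply: contraT => wl.
have := boundM _ l (wR _ root3); have := boundM _ l (wR _ root2).
rewrite wD (additive_opp wD) (additive_mulrz wD) coordD coordN coordMz.
have : `|w (alpha i1) l * cartan C b i1 j1| > 2 * M.
  rewrite normrM (lt_le_trans (y := `|cartan C b i1 j1|)) //; first by lia.
  by rewrite ler_peMl // -gtz0_ge1 normr_gt0.
by lia.
Qed.
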